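(* Let $Q$ be a generalized quadrangle of order $q$ and let $G$ be the incidence graph of $Q$. Then $Q$ contains two disjoint ovoids or two disjoint spreads if and only if $$\chi_\rho (G)=(q^2+1)(q-1)+3.$$
   Context: All graphs are finite, simple and undirected. A packing $k$-coloring of a graph $G$ is a function $\Gamma: V(G)\to\{1,2,\dots,k\}$ such that for every $i$, any two distinct vertices of color $i$ are at distance at least $i+1$. The packing chromatic number $\chi_\rho(G)$ is the smallest integer $k$ for which $G$ has a packing $k$-coloring. Let $\mathcal{P}$ (points) and $\mathcal{L}$ (lines) be disjoint non-empty sets with an incidence relation $I$ between them. The incidence graph is the bipartite graph on $\mathcal{P}\cup\mathcal{L}$ in which each point is joined to its incident lines. A generalized quadrangle of order $q$ (symmetric generalized $4$-gon), $q\ge 1$ an integer, is a triple $(\mathcal{P},\mathcal{L},I)$ such that every line is incident to exactly $q+1$ points and every point to exactly $q+1$ lines; any two distinct lines intersect in at most one point and there is at most one line through any two distinct points; and the incidence graph has diameter $4$ and girth $8$. Distances between elements of $Q$ are taken in the incidence graph. Two points (or two lines) are opposite if they are at distance $4$. An ovoid (resp. spread) of $Q$ is a set of $q^2+1$ mutually opposite points (resp. lines) such that every element of $Q$ (point or line) is at distance at most $2$ from at least one point (resp. line) of the set. *)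

(* Defs.v *)
From mathcomp Require Import all_boot.
Set Implicit Arguments.
Unset Strict Implicit.
Unset Printing Implicit Defensive.

Record sgraph := SGraph {
  vertex :> finType;
  edge : rel vertex;
  edge_sym : symmetric edge;
  edge_irr : irreflexive edge
}.

Section Graph.
Variable G : sgraph.
Implicit Types x y : G.

Definition has_walk (n : nat) x y : bool :=
  [exists p : n.-tuple G, path (@edge G) x p && (last x p == y)].

(* [None] stands for infinite distance.  A shortest walk repeats no vertex,
   hence the bound #|G| on the lengths to be searched; see [dist_SomeP] and
   [dist_NoneP]. *)
Definition dist x y : option nat :=
  ohead [seq n <- iota 0 #|G| | has_walk n x y].

Definition dist_at_least (d : nat) x y : bool :=
  if dist x y is Some n then d <= n else true.

Definition dist_at_most (d : nat) x y : bool :=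
  if dist x y is Some n then n <= d else false.

Lemma has_walkP n x y :
  reflect (exists p : seq G,
             [/\ path (@edge G) x p, last x p = y & size p = n])
          (has_walk n x y).
Proof.
apply: (iffP existsP) => [[p /andP[ep /eqP lp]]|[p [ep lp sp]]].
  by exists p; rewrite size_tuple.
by exists (tcast sp (in_tuple p)); rewrite val_tcast /= ep lp eqxx.
Qed.

Lemma has_walk_shorten n x y :
  has_walk n x y -> exists2 m, m < #|G| & (m <= n) && has_walk m x y.
Proof.
case/has_walkP=> p [ep <- <-]; case: (shortenP ep) => p' ep' up' sub_p'.
exists (size p').
  by rewrite -[(size p').+1]/(size (x :: p')) -(card_uniqP up') max_card.
apply/andP; split; last by apply/has_walkP; exists p'.
by apply: uniq_leq_size sub_p'; case/andP: up'.
Qed.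

Lemma dist_SomeP d x y :
  dist x y = Some d <-> has_walk d x y /\ (forall n, has_walk n x y -> d <= n).
Proof.
have minP k m e : ohead [seq n <- iota m k | has_walk n x y] = Some e ->
  has_walk e x y /\ (forall n, m <= n < m + k -> has_walk n x y -> e <= n).
  elim: k m => //= k IH m; case: ifP => [wm [<-]|wm /IH[we min_e]].
    by split=> // n /andP[].
  split=> // n /andP[]; rewrite leq_eqVlt => /predU1P[<-|lt_mn lt_n].
    by rewrite wm.
  by apply: min_e; rewrite lt_mn addSn -addnS.
have exD n : has_walk n x y -> exists e, dist x y = Some e.
  case/has_walk_shorten=> m lt_m /andP[_ wm]; rewrite /dist.
  have: m \in [seq n <- iota 0 #|G| | has_walk n x y].
    by rewrite mem_filter wm mem_iota.
  by case: filter => //= e s _; exists e.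
have minD e : dist x y = Some e ->
    has_walk e x y /\ (forall n, has_walk n x y -> e <= n).
  case/minP=> we min_e; split=> // n /has_walk_shorten[m lt_m /andP[le_mn wm]].
  by apply: leq_trans le_mn; apply: min_e.
split=> [/minD //|[wd min_d]].
have [e De] := exD _ wd; have [we min_e] := minD _ De.
by rewrite De; congr Some; apply/eqP; rewrite eqn_leq min_e ?min_d.
Qed.

Lemma dist_NoneP x y : dist x y = None <-> forall n, ~~ has_walk n x y.
Proof.
split=> [DN n|noW].
  apply/negP=> /has_walk_shorten[m lt_m /andP[_ wm]].
  have: m \in [seq n <- iota 0 #|G| | has_walk n x y].
    by rewrite mem_filter wm mem_iota.
  by move: DN; rewrite /dist; case: filter.
case Dd: (dist x y) => [d|//].
by have [wd _] := (dist_SomeP d x y).1 Dd; have := noW d; rewrite wd.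
Qed.

Definition has_diameter (d : nat) : Prop :=
  (forall x y, dist_at_most d x y) /\ (exists x y, dist x y = Some d).

(* [ucycle] also accepts the empty list and [:: x; y] for an edge xy, whence
   the lower bound on the size. *)
Definition graph_cycle (c : seq G) : Prop :=
  ucycle (@edge G) c /\ 3 <= size c.

Definition has_girth (g : nat) : Prop :=
  (exists2 c, graph_cycle c & size c = g) /\
  (forall c, graph_cycle c -> g <= size c).

Definition packing_coloring (k : nat) (c : G -> nat) : bool :=
  [forall x, 1 <= c x <= k] &&
  [forall x, forall y, (x != y) && (c x == c y) ==>
                         dist_at_least (c x).+1 x y].

Definition packing_colorable (k : nat) : bool :=
  [exists c : {ffun G -> 'I_k.+1}, packing_coloring k (fun x => c x)].

Lemma packing_colorableP k :
  reflect (exists c : G -> nat, packing_coloring k c) (packing_colorable k).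
Proof.
apply: (iffP existsP) => [[c cP]|[c cP]]; first by exists (fun x => c x : nat).
exists [ffun x => inord (c x) : 'I_k.+1].
have{cP} /andP[/forallP c_k /forallP cP] := cP.
have cE x : [ffun x => inord (c x) : 'I_k.+1] x = c x :> nat.
  by rewrite ffunE inordK // ltnS; case/andP: (c_k x).
apply/andP; split; apply/forallP=> x; rewrite ?cE //.
by apply/forallP=> y; rewrite !cE; apply: (forallP (cP x)).
Qed.

Lemma exists_packing_colorable : exists k, packing_colorable k.
Proof.
exists #|G|; apply/packing_colorableP; exists (fun x => (enum_rank x).+1).
apply/andP; split; apply/forallP=> x; first by rewrite ltn_ord.
apply/forallP=> y; apply/implyP=> /andP[/eqP neq_xy].
by rewrite eqSS => /eqP/ord_inj/enum_rank_inj.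
Qed.

Definition packing_chromatic_number : nat := ex_minn exists_packing_colorable.

End Graph.

Section Incidence.
Variables (P L : finType) (I : P -> L -> bool).

Definition inc_edge : rel (P + L) := fun u v =>
  match u, v with
  | inl p, inr l | inr l, inl p => I p l
  | _, _ => false
  end.

Lemma inc_edge_sym : symmetric inc_edge. Proof. by case=> ? []. Qed.

Lemma inc_edge_irr : irreflexive inc_edge. Proof. by case. Qed.

Definition incidence_graph : sgraph := SGraph inc_edge_sym inc_edge_irr.

Record generalized_quadrangle (q : nat) : Prop := GeneralizedQuadrangle {
  gq_order_gt0 : 1 <= q;
  gq_points_nonempty : 0 < #|P|;
  gq_lines_nonempty : 0 < #|L|;
  gq_line_size : forall l, #|[set p | I p l]| = q.+1;
  gq_point_size : forall p, #|[set l | I p l]| = q.+1;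
  gq_lines_meet : forall l m, l != m -> #|[set p | I p l & I p m]| <= 1;
  gq_points_join : forall p r, p != r -> #|[set l | I p l & I r l]| <= 1;
  gq_diameter : has_diameter incidence_graph 4;
  gq_girth : has_girth incidence_graph 8
}.

Definition opposite (u v : incidence_graph) : Prop := dist u v = Some 4.

Definition ovoid (q : nat) (O : {set P}) : Prop :=
  [/\ #|O| = q ^ 2 + 1,
      {in O &, forall p r, p != r -> opposite (inl p) (inl r)} &
      forall u : incidence_graph, exists2 p, p \in O & dist_at_most 2 u (inl p)].

Definition spread (q : nat) (S : {set L}) : Prop :=
  [/\ #|S| = q ^ 2 + 1,
      {in S &, forall l m, l != m -> opposite (inr l) (inr m)} &
      forall u : incidence_graph, exists2 l, l \in S & dist_at_most 2 u (inr l)].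

Definition has_two_disjoint_ovoids (q : nat) : Prop :=
  exists O1 O2 : {set P}, [/\ ovoid q O1, ovoid q O2 & [disjoint O1 & O2]].

Definition has_two_disjoint_spreads (q : nat) : Prop :=
  exists S1 S2 : {set L}, [/\ spread q S1, spread q S2 & [disjoint S1 & S2]].

End Incidence.

(* Main.v *)
(* Each color above 3 occurs at most once since the diameter is 4, and color 3 is
   confined to points or to lines, hence occurs at most q^2 + 1 times, that being
   the maximal size of a partial ovoid.  The crux is that colors 1 and 2 together
   cover at most (q + 2)(q^2 + 1) of the 2(q + 1)(q^2 + 1) vertices, with equality
   only if color 1 fills all the points or all the lines and color 2 is a spread,
   resp. an ovoid.  Hence at least (q - 1)(q^2 + 1) + 3 colors are needed, and if
   these suffice then colors 2 and 3 are two disjoint ovoids or spreads. *)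
Require Import Defs.
From mathcomp Require Import all_boot zify.
Set Implicit Arguments.
Unset Strict Implicit.
Unset Printing Implicit Defensive.

Lemma card_sum_mem (T : finType) (A : {set T}) : #|A| = \sum_x (x \in A).
Proof. by rewrite -sum1_card big_mkcond; apply: eq_bigr => x _; case: (x \in A). Qed.

(** * Walks, distances and colorings given by three classes *)

Section Distance.
Variable G : sgraph.
Implicit Types x y : G.

Lemma dist_at_leastP d x y :
  reflect (forall n, n < d -> ~~ has_walk n x y) (dist_at_least d x y).
Proof.
rewrite /dist_at_least; case Dxy: (dist x y) => [e|]; last first.
  by left=> n _; apply: (dist_NoneP x y).1.
have [we min_e] := (dist_SomeP e x y).1 Dxy.
apply: (iffP idP) => [le_de n lt_nd | now].
  by apply/negP=> /min_e; lia.
by rewrite leqNgt; apply/negP=> /now; rewrite we.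
Qed.

Lemma dist_at_mostP d x y :
  reflect (exists2 n, n <= d & has_walk n x y) (dist_at_most d x y).
Proof.
rewrite /dist_at_most; case Dxy: (dist x y) => [e|]; last first.
  by right=> -[n _]; apply/negP/(dist_NoneP x y).1.
have [we min_e] := (dist_SomeP e x y).1 Dxy.
apply: (iffP idP) => [|[n le_nd /min_e]]; last by lia.
by exists e.
Qed.

Lemma has_walk1 x y : has_walk 1 x y = edge x y.
Proof.
apply/has_walkP/idP=> [[[|z [|t s]] [//= + <- //]]|exy]; first by case/andP.
by exists [:: y]; rewrite /= exy.
Qed.

Lemma has_walk2 x y : has_walk 2 x y = [exists z, edge x z && edge z y].
Proof.
apply/has_walkP/existsP=> [[[|z [|t [|u s]]] [//= + <- //]]|].
  by case/and3P=> exz ezt _; exists z; rewrite exz.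
by case=> z /andP[exz ezy]; exists [:: z; y]; rewrite /= exz ezy.
Qed.

(** Giving each vertex outside the three sets a color of its own leaves only colors 1, 2 and 3 to
    check. *)
Lemma packing_colorable_of_classes (D S1 S2 : {set G}) :
    {in D &, forall x y, x != y -> dist_at_least 2 x y} ->
    {in S1 &, forall x y, x != y -> dist_at_least 3 x y} ->
    {in S2 &, forall x y, x != y -> dist_at_least 4 x y} ->
  packing_colorable G (#|~: (D :|: S1 :|: S2)| + 3).
Proof.
move=> dD dS1 dS2; set U := ~: _.
(* [index] starts at 0, so the vertices of [U] get the colors from 4 to [#|U| + 3]. *)
pose c x := if x \in D then 1 else if x \in S1 then 2 else
            if x \in S2 then 3 else index x (enum U) + 4.
have inU x : x \notin D -> x \notin S1 -> x \notin S2 -> x \in U.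
  by rewrite !inE => /negPf-> /negPf-> /negPf->.
apply/packing_colorableP; exists c; apply/andP; split.
  apply/forallP=> x; rewrite /c.
  have [_|xD] := boolP (x \in D); first by lia.
  have [_|xS1] := boolP (x \in S1); first by lia.
  have [_|xS2] := boolP (x \in S2); first by lia.
  have: index x (enum U) < #|U| by rewrite cardE index_mem mem_enum; apply: inU.
  by lia.
apply/forallP=> x; apply/forallP=> y; apply/implyP=> /andP[neq_xy].
rewrite /c.
have [xD|xD] := boolP (x \in D).
  have [yD _|yD] := boolP (y \in D); first exact: dD.
  by do 2?case: ifP => _; rewrite // addnC.
have [xS1|xS1] := boolP (x \in S1).
  have [//|yD] := boolP (y \in D).
  have [yS1 _|yS1] := boolP (y \in S1); first exact: dS1.
  by case: ifP => _; rewrite // addnC.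
have [xS2|xS2] := boolP (x \in S2).
  have [//|yD] := boolP (y \in D); have [//|yS1] := boolP (y \in S1).
  have [yS2 _|yS2] := boolP (y \in S2); first exact: dS2.
  by rewrite addnC.
have [yD|yD] := boolP (y \in D); first by rewrite addnC.
have [yS1|yS1] := boolP (y \in S1); first by rewrite addnC.
have [yS2|yS2] := boolP (y \in S2); first by rewrite addnC.
rewrite eqn_add2r => /eqP/(index_inj x) eq_xy; case/eqP: neq_xy.
by apply: eq_xy; rewrite mem_enum; apply: inU.
Qed.

End Distance.

(* A form of the quadrangle axioms that exchanging points and lines preserves
   verbatim. *)
Record quadrangle (P L : finType) (I : P -> L -> bool) (q : nat) : Prop := {
  quad_line l : \sum_p I p l = q.+1;
  quad_point p : \sum_l I p l = q.+1;
  quad_flag p r l m : I p l -> I r l -> I p m -> I r m -> p = r \/ l = m;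
  quad_proj p l : exists m r, [/\ I p m, I r m & I r l];
  quad_proj_uniq p l m r m' r' : ~~ I p l ->
    I p m -> I r m -> I r l -> I p m' -> I r' m' -> I r' l -> m = m' /\ r = r'
}.

Definition dual (P L : finType) (I : P -> L -> bool) l p := I p l.

Lemma dual_quadrangle (P L : finType) (I : P -> L -> bool) q :
  quadrangle I q -> quadrangle (dual I) q.
Proof.
case=> hl hp flag proj uproj; rewrite /dual; split=> //.
- by move=> l m p r plI pmI rlI rmI; have [] := flag p r l m plI rlI pmI rmI; [right|left].
- by move=> l p; have [m [r [pm rm rl]]] := proj p l; exists r, m.
move=> l p r m r' m' lp rl rm pm r'l r'm' pm'.
by have [] := uproj p l m r m' r' lp pm rm rl pm' r'm' r'l.
Qed.

(** For [dual I] this is a partial spread, so results on partial ovoids serve both sides. *)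
Definition partial_ovoid (P L : finType) (I : P -> L -> bool) (A : {set P}) :=
  forall p r l, p \in A -> r \in A -> I p l -> I r l -> p = r.

(** * Flag counting in a quadrangle *)

Section Quadrangle.
Variables (P L : finType) (I : P -> L -> bool) (q : nat).
Hypothesis quadI : quadrangle I q.
Implicit Types (A X : {set P}) (B Y T : {set L}).

Local Notation deg X l := (\sum_(p in X) I p l).

Lemma sum_deg X : \sum_l deg X l = q.+1 * #|X|.
Proof.
rewrite exchange_big /= (eq_bigr (fun=> q.+1)) => [|p _].
  by rewrite sum_nat_const mulnC.
exact: quad_point quadI p.
Qed.

Lemma deg_le X l : deg X l <= q.+1.
Proof.
rewrite -(quad_line quadI l) [leqRHS](bigID (mem X)) /=.
exact: leq_addr.
Qed.

Lemma deg_disjoint X A l : [disjoint X & A] -> deg X l + deg A l <= q.+1.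
Proof.
move=> dXA; rewrite -bigU //=; apply: leq_trans (deg_le (X :|: A) l).
by rewrite (eq_bigl (mem (X :|: A))) // => p; rewrite !inE.
Qed.

Lemma deg_gt0 X p l : p \in X -> I p l -> 0 < deg X l.
Proof. by move=> Xp pl; rewrite (bigD1 p) //= pl. Qed.

Lemma deg_eq0 X l : (forall p, p \in X -> ~~ I p l) -> deg X l = 0.
Proof. by move=> nX; apply: big1 => p /nX/negPf->. Qed.

Lemma deg_full X p l : deg X l = q.+1 -> I p l -> p \in X.
Proof.
move=> dX pl; apply/negPn/negP=> nXp.
have := quad_line quadI l; rewrite (bigID (mem X)) /= dX.
by rewrite [X in _ + X](bigD1 p) //= pl; lia.
Qed.

Lemma partial_ovoid_deg A l : partial_ovoid I A -> deg A l <= 1.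
Proof.
move=> ovA; case: (pickP [pred p in A | I p l]) => [p /andP[Ap pl] | nA].
  rewrite (bigD1 p) //= pl big1 // => r /andP[Ar neq_rp].
  by case rl: (I r l) => //; case/eqP: neq_rp; apply: ovA rl pl.
by rewrite deg_eq0 // => p Ap; have /= := nA p; rewrite Ap /= => ->.
Qed.

Lemma exists_point l : exists p, I p l.
Proof.
apply/existsP; apply: contraPT (quad_line quadI l) => /existsPn nI.
by rewrite big1 // => p _; rewrite (negPf (nI p)).
Qed.

Lemma exists_line p : exists l, I p l.
Proof.
apply/existsP; apply: contraPT (quad_point quadI p) => /existsPn nI.
by rewrite big1 // => l _; rewrite (negPf (nI l)).
Qed.

(** From a point of [X], the path [p], [m], [r], [l] of [quad_proj] reaches any line [l], and the
    closure conditions keep it inside [X] and [T]. *)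
Lemma quad_connected X T :
    (forall p l, p \in X -> I p l -> l \in T) ->
    (forall p l, l \in T -> I p l -> p \in X) ->
  X = set0 /\ T = set0 \/ X = setT /\ T = setT.
Proof.
move=> XT TX; have [X0 | [p Xp]] := set_0Vmem X.
  left; split=> //; apply/setP=> l; rewrite inE; apply/negP=> Tl.
  by have [p pl] := exists_point l; have := TX p l Tl pl; rewrite X0 inE.
have allT l : l \in T.
  have [m [r [pm rm rl]]] := quad_proj quadI p l.
  exact: XT (TX _ _ (XT _ _ Xp pm) rm) rl.
right; split; apply/setP=> x; rewrite inE; last exact: allT.
by have [l xl] := exists_line x; apply: TX xl.
Qed.

(* The flags (p, m, r) with p, r on m and r on l are counted by r, giving
   (q + 1)^3, and by p: there is one for each p off l, and 2q + 1 for each of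
   the q + 1 points of l. *)
Lemma card_points (l : L) : #|P| = q.+1 * (q ^ 2 + 1).
Proof.
pose f p := \sum_r \sum_m (I p m && I r m && I r l).
have sum_f : \sum_p f p = q.+1 * (q.+1 * q.+1).
  rewrite /f exchange_big /=.
  transitivity (\sum_r I r l * (q.+1 * q.+1)); last first.
    by rewrite -big_distrl /= (quad_line quadI).
  apply: eq_bigr => r _; rewrite exchange_big /=.
  transitivity (\sum_m I r l * (I r m * q.+1)); last first.
    by rewrite -!big_distrr -big_distrl /= (quad_point quadI).
  apply: eq_bigr => m _; rewrite -(quad_line quadI m) !big_distrr /=.
  by apply: eq_bigr => p _; case: (I p m); case: (I r m); case: (I r l).
have f_off p : ~~ I p l -> f p = 1.
  move=> npl; have [m [r [pm rm rl]]] := quad_proj quadI p l.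
  have uniq_mr m' r' : I p m' && I r' m' && I r' l -> m = m' /\ r = r'.
    by case/andP=> /andP[pm' rm'] rl'; apply: (quad_proj_uniq quadI) npl _ _ _ _ _ _.
  rewrite /f (bigD1 r) //= (bigD1 m) //= big1 => [|m' neq]; last first.
    by case E: (_ && _) => //; have [Em _] := uniq_mr _ _ E; rewrite Em eqxx in neq.
  rewrite big1 ?pm ?rm ?rl // => r' neq; apply: big1 => m' _.
  by case E: (_ && _) => //; have [_ Er] := uniq_mr _ _ E; rewrite Er eqxx in neq.
(* The line [l] itself allows [q.+1] choices of [r]; each of the other [q] lines through [p] allows
   only [r = p]. *)
have f_on p : I p l -> f p = 2 * q + 1.
  move=> pl; rewrite /f exchange_big (bigD1 l) //=.
  have -> : \sum_r (I p l && I r l && I r l) = q.+1.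
    rewrite -(quad_line quadI l); apply: eq_bigr => r _.
    by rewrite pl andbb.
  have: \sum_m I p m = q.+1 := quad_point quadI p.
  rewrite (bigD1 l) //= pl add1n => -[sum_q].
  rewrite (eq_bigr (fun m => I p m : nat)) ?sum_q; first by lia.
  move=> m neq_ml; rewrite (bigD1 p) //= andbb pl andbT big1 ?addn0 // => r neq.
  case pm: (I p m) => //=; case rm: (I r m) => //=; case rl: (I r l) => //.
  have [E|E] := quad_flag quadI pm rm pl rl; first by rewrite E eqxx in neq.
  by rewrite E eqxx in neq_ml.
(* Adding [2 * q] at the points off [l] makes the summand constant. *)
have: \sum_p (f p + 2 * q * (~~ I p l)) = (2 * q + 1) * #|P|.
  rewrite (eq_bigr (fun=> 2 * q + 1)) => [|p _].
    by rewrite sum_nat_const mulnC.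
  case pl: (I p l); last by rewrite f_off ?pl // muln1 addnC.
  by rewrite f_on // muln0 addn0.
have: \sum_p (~~ I p l) + \sum_p I p l = #|P|.
  by rewrite -big_split -sum1_card; apply: eq_bigr => p _; case: (I p l).
rewrite big_split sum_f -big_distrr (quad_line quadI) /= -mulnn => <-; lia.
Qed.

End Quadrangle.

Lemma card_lines (P L : finType) (I : P -> L -> bool) q :
  quadrangle I q -> P -> #|L| = q.+1 * (q ^ 2 + 1).
Proof. by move/dual_quadrangle=> quadI; apply: card_points quadI. Qed.

(** * Partial ovoids and the bound for colors 1 and 2 *)

Section PartialOvoid.
Variables (P L : finType) (I : P -> L -> bool) (q : nat).
Hypothesis quadI : quadrangle I q.
Implicit Types (A X : {set P}) (B Y T : {set L}).

Local Notation deg X l := (\sum_(p in X) I p l).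

(** Each line carries at most one point of [A], so there are at most [#|L|] flags through [A]. *)
Lemma partial_ovoid_card A : partial_ovoid I A -> #|A| <= q ^ 2 + 1.
Proof.
move=> ovA; have [-> | [p _]] := set_0Vmem A; first by rewrite cards0.
rewrite -(@leq_pmul2l q.+1) // -(card_lines quadI p) -(sum_deg quadI) -sum1_card.
by apply: leq_sum => l _; apply: partial_ovoid_deg ovA.
Qed.

(** At this size the flags through [A] are as many as the lines; with at most one flag per line, no
    line is left out. *)
Lemma partial_ovoid_meets A l :
  partial_ovoid I A -> #|A| = q ^ 2 + 1 -> exists2 p, p \in A & I p l.
Proof.
move=> ovA card_A; case: (pickP [pred p in A | I p l]) => [p /andP[]|nA].
  by exists p.
have [p _] := exists_point quadI l.
have := sum_deg quadI A; rewrite card_A -(card_lines quadI p) -sum1_card.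
rewrite (bigD1 l) // [RHS](bigD1 l) //= deg_eq0 => [|r Ar]; last first.
  by have /= := nA r; rewrite Ar /= => ->.
have: \sum_(m | m != l) deg A m <= \sum_(m | m != l) 1.
  by apply: leq_sum => m _; apply: partial_ovoid_deg ovA.
by lia.
Qed.

(* [X], [Y] play the points and lines of color 1 and [A], [B] those of color 2.
   With [N] the set of lines outside [B] that meet [X], [Y] misses [B] and [N],
   so it suffices to bound [#|X| + #|A|] by [#|N| + q ^ 2 + 1].  Counting the
   flags through [X] with all lines bounded by [q + 1] does so when
   [#|A| + #|B| <= q ^ 2 + 1]; otherwise one uses that a point of [X] is on at
   most one line of [B] and that a line of [N] meeting [A] has at most [q] points
   in [X].  In the equality case [X] together with [B :|: N] is closed under
   incidence, hence empty or everything. *)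
Lemma card_independent_partial X A Y B :
    0 < q -> P -> partial_ovoid I A -> partial_ovoid (dual I) B ->
    [disjoint X & A] -> [disjoint Y & B] ->
    (forall p l, p \in A -> l \in B -> ~~ I p l) ->
    (forall p l, p \in X -> l \in Y -> ~~ I p l) ->
  #|X| + #|A| + #|Y| + #|B| <= q.+2 * (q ^ 2 + 1) /\
  (#|X| + #|A| + #|Y| + #|B| = q.+2 * (q ^ 2 + 1) ->
     X = setT /\ #|B| = q ^ 2 + 1 \/ Y = setT /\ #|A| = q ^ 2 + 1).
Proof.
move=> q_gt0 p0 ovA spB dXA dYB nAB nXY.
have cardL := card_lines quadI p0.
have [l0 _] := exists_line quadI p0.
have cardP := card_points quadI l0.
pose N := [set l in ~: B | 0 < deg X l].
have degX_out l : l \notin B -> l \notin N -> deg X l = 0.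
  by rewrite !inE => -> /=; lia.
have flagX : q.+1 * #|X| = \sum_(l in B) deg X l + \sum_(l in N) deg X l.
  rewrite -(sum_deg quadI) (bigID (mem B)) /=; congr (_ + _).
  rewrite (bigID (mem N)) /= [X in _ + X]big1 ?addn0 => [|l /andP[]].
    by apply: eq_bigl => l; rewrite !inE; case: (l \in B).
  exact: degX_out.
have BX_le : \sum_(l in B) deg X l <= #|X|.
  rewrite exchange_big -sum1_card; apply: leq_sum => p _ /=.
  exact: (@partial_ovoid_deg _ _ (dual I)) spB.
have leBX : \sum_(l in B) deg X l <= q.+1 * #|B|.
  by rewrite mulnC -sum_nat_const; apply: leq_sum => l _; apply: deg_le.
have leNX : \sum_(l in N) deg X l <= q.+1 * #|N|.
  by rewrite mulnC -sum_nat_const; apply: leq_sum => l _; apply: deg_le.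
have leNXA : \sum_(l in N) deg X l + \sum_(l in N) deg A l <= q.+1 * #|N|.
  rewrite -big_split mulnC -sum_nat_const.
  by apply: leq_sum => l _; apply: deg_disjoint.
(* Compared line by line: a line of [B] misses [A], a line of [N] gives equality, and any other line
   meets [A] at most once. *)
have flagA : q.+1 * #|A| + #|N| + #|B| <= \sum_(l in N) deg A l + #|L|.
  rewrite -(sum_deg quadI) -[#|L|]sum1_card [X in _ <= X + _]big_mkcond.
  rewrite !card_sum_mem -!big_split; apply: leq_sum => l _ /=; rewrite !inE.
  have [lB|_] := boolP (l \in B).
    by rewrite deg_eq0 // => p Ap; apply: nAB.
  by case: (0 < deg X l); rewrite /= ?addn0 ?partial_ovoid_deg.
have leY : #|Y| + #|B| + #|N| <= #|L|.
  rewrite -[#|L|]sum1_card !card_sum_mem -!big_split.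
  apply: leq_sum => l _ /=; rewrite !inE.
  have [lB|_] := boolP (l \in B); first by rewrite (disjointFl dYB lB).
  have [lY|_] := boolP (l \in Y); last by case: (0 < _).
  by rewrite deg_eq0 // => p Xp; apply: nXY.
have leA := partial_ovoid_card ovA.
have full T l : \sum_(l in T) deg X l = q.+1 * #|T| -> l \in T -> deg X l = q.+1.
  move=> + Tl; rewrite mulnC -sum_nat_const (bigD1 l) //= [RHS](bigD1 l) //=.
  have: \sum_(i in T | i != l) deg X i <= \sum_(i in T | i != l) q.+1.
    by apply: leq_sum => m _; apply: deg_le.
  by have := deg_le quadI X l; lia.
(* This is the sum of [flagX], [BX_le], [leNXA] and [flagA]. *)
have {flagA leNXA BX_le} excess :
    q * (#|X| + #|A|) + #|A| + #|B| <= q * (#|N| + (q ^ 2 + 1)) + (q ^ 2 + 1).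
  rewrite cardL in flagA; lia.
have {leBX leNX} leX : #|X| <= #|B| + #|N| /\
    (#|X| = #|B| + #|N| -> forall l, l \in B :|: N -> deg X l = q.+1).
  split=> [|eqX l]; first by rewrite -(@leq_pmul2l q.+1) //; lia.
  by rewrite eqX in flagX; rewrite inE => /orP[]; apply: full; lia.
have key : #|X| + #|A| <= #|N| + (q ^ 2 + 1) /\
    (#|X| + #|A| = #|N| + (q ^ 2 + 1) -> #|A| + #|B| = q ^ 2 + 1).
  (* The first case follows from [leX]; in the second, [excess] makes the inequality strict. *)
  have [le_AB|lt_AB] := leqP (#|A| + #|B|) (q ^ 2 + 1); first by lia.
  suff: #|X| + #|A| < #|N| + (q ^ 2 + 1) by lia.
  by rewrite -(ltn_pmul2l q_gt0); lia.
rewrite cardL in leY; split=> [|eq_sum]; first by lia.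
(* With [leY], equality in the total forces equality in [key], hence [#|X| = #|B| + #|N|]: every
   line of [B :|: N] then lies wholly in [X]. *)
have eqAB : #|A| + #|B| = q ^ 2 + 1 by apply: key.2; lia.
have deg_BN := leX.2 ltac:(lia).
have XT p l : p \in X -> I p l -> l \in B :|: N.
  move=> Xp pl; rewrite !inE (deg_gt0 Xp pl) andbT; exact: orbN.
have TX p l : l \in B :|: N -> I p l -> p \in X.
  by move=> /deg_BN; apply: deg_full.
have [[X0 BN0]|[XT1 BN1]] := quad_connected quadI XT TX.
  right; have B0 : #|B| = 0.
    by apply/eqP; rewrite cards_eq0 -subset0 -BN0 subsetUl.
  have N0 : #|N| = 0.
    by apply/eqP; rewrite cards_eq0 -subset0 -BN0 subsetUr.
  split; last by lia.
  by apply/eqP; rewrite eqEcard subsetT cardsT cardL; lia.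
have A0 : #|A| = 0.
  by apply: eq_card0 => p; apply: (disjointFr dXA); rewrite XT1 inE.
by left; split=> //; lia.
Qed.

End PartialOvoid.

(** * From distances in the incidence graph to the quadrangle axioms *)

Section IncidenceGraph.
Variables (P L : finType) (I : P -> L -> bool) (q : nat).
Hypothesis gqI : generalized_quadrangle I q.

Local Notation G := (incidence_graph I).

Definition is_point (u : G) := if u is inl _ then true else false.

Lemma walk_parity n (u v : G) : has_walk n u v -> odd n = is_point u (+) is_point v.
Proof.
case/has_walkP=> s [+ <- <-]; elim: s u => [u _|w s IH u] /=; first by rewrite addbb.
case/andP=> uw /IH->; rewrite -addNb; congr (_ (+) _).
by case: u w uw => [p|l] [r|m].
Qed.

(** The diameter and parity leave the distances 0, 2 and 4, and the hypotheses exclude the first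
    two. *)
Lemma opposite_of_no_common_neighbour (u v : G) :
    is_point u = is_point v -> u != v ->
    (forall w, ~~ (edge u w && edge w v)) -> opposite u v.
Proof.
move=> uv neq_uv nw; rewrite /opposite.
have := (gq_diameter gqI).1 u v; rewrite /dist_at_most.
case Duv: (dist u v) => [e|//] le_e4; congr Some.
have [we _] := (dist_SomeP e u v).1 Duv.
have := walk_parity we; rewrite uv addbb.
case: e {Duv} le_e4 we => [|[|[|[|[|e]]]]] //= _.
  by case/has_walkP=> -[[_ /= Euv _]|? ? [_ _]//]; rewrite Euv eqxx in neq_uv.
by rewrite has_walk2 => /existsP[w]; rewrite (negPf (nw w)).
Qed.

(** Projections exist because the diameter is 4, and are unique because two of them would close a
    cycle shorter than the girth. *)
Lemma quadrangle_of_gq : quadrangle I q.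
Proof.
have meet l m p r : l != m -> I p l -> I p m -> I r l -> I r m -> p = r.
  move=> neq_lm pl pm rl rm; have /card_le1_eqP := gq_lines_meet gqI neq_lm.
  by apply; rewrite inE ?pl ?rl.
split=> [l|p|p r l m pl rl pm rm|p l|p l m r m' r' npl pm rm rl pm' rm' rl'].
- by rewrite -(gq_line_size gqI l) card_sum_mem; apply: eq_bigr => p _; rewrite inE.
- by rewrite -(gq_point_size gqI p) card_sum_mem; apply: eq_bigr => l _; rewrite inE.
- by have [->|/meet/(_ pl pm rl rm)->] := eqVneq l m; [right | left].
- have /dist_at_mostP[n] := (gq_diameter gqI).1 (inl p) (inr l).
  move=> le_n4 wn; have := walk_parity wn; move: wn le_n4.
  (* Only the lengths 1 and 3 survive parity and the bound 4; for length 1, [l] and [p] themselves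
     are the witnesses. *)
  case/has_walkP=> -[|u [|v [|w [|t [|z s]]]]] [ep + <-] //= _ _.
    by move: ep => /= /andP[+ _] Eu; rewrite Eu => pl; exists l, p.
  move: ep => /= /and4P[+ + + _] Ew; rewrite Ew.
  by case: u v => [//|m] [r|//] /= pm rm rl; exists m, r.
have neq_pr r0 : I r0 l -> p != r0 by apply: contraTneq => <-.
have [Em|neq_m] := eqVneq m m'.
  split=> //; rewrite -Em in pm' rm'.
  have neq_ml : m != l by apply: contraNneq npl => <-.
  exact: meet neq_ml rm rl rm' rl'.
have [Er|neq_r] := eqVneq r r'.
  have := neq_pr r rl; rewrite -Er in rm'.
  by rewrite (meet _ _ _ _ neq_m pm pm' rm rm') eqxx.
(* Two distinct projections of [p] onto [l] yield a hexagon, against girth 8. *)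
pose c : seq G := [:: inl p; inr m; inl r; inr l; inl r'; inr m'].
have /(gq_girth gqI).2 // : graph_cycle c.
have neq_l m0 : I p m0 -> m0 != l by apply: contraTneq => ->.
split=> //; apply/andP; split; rewrite /= ?pm ?rm ?rl ?rl' ?rm' ?pm' //.
rewrite !inE !(inj_eq inl_inj, inj_eq inr_inj) /= !negb_or !andbT.
by rewrite !neq_pr // neq_r neq_m neq_l // eq_sym neq_l.
Qed.

Let quadI := quadrangle_of_gq.

(** Covering comes from [partial_ovoid_meets]: every line has a point in [A], and a point reaches
    [A] through any of its lines. *)
Lemma ovoid_of_partial (A : {set P}) :
  partial_ovoid I A -> #|A| = q ^ 2 + 1 -> ovoid I q A.
Proof.
move=> ovA card_A; split=> // [p r Ap Ar neq_pr|].
  apply: opposite_of_no_common_neighbour => // -[//|l].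
  by apply/negP=> /andP[/= pl rl]; case/eqP: neq_pr; apply: ovA pl rl.
case=> [r|l].
  have [l rl] := exists_line quadI r.
  have [p Ap pl] := partial_ovoid_meets quadI l ovA card_A.
  exists p => //; apply/dist_at_mostP; exists 2; rewrite // has_walk2.
  by apply/existsP; exists (inr l); rewrite /= rl.
have [p Ap pl] := partial_ovoid_meets quadI l ovA card_A.
by exists p => //; apply/dist_at_mostP; exists 1; rewrite // has_walk1.
Qed.

Lemma spread_of_partial (B : {set L}) :
  partial_ovoid (dual I) B -> #|B| = q ^ 2 + 1 -> spread I q B.
Proof.
move=> spB card_B; split=> // [l m Bl Bm neq_lm|].
  apply: opposite_of_no_common_neighbour => // -[p|//].
  by apply/negP=> /andP[/= pl pm]; case/eqP: neq_lm; apply: spB pl pm.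
case=> [p|m].
  have [l Bl pl] := partial_ovoid_meets (dual_quadrangle quadI) p spB card_B.
  by exists l => //; apply/dist_at_mostP; exists 1; rewrite // has_walk1.
have [p pm] := exists_point quadI m.
have [l Bl pl] := partial_ovoid_meets (dual_quadrangle quadI) p spB card_B.
exists l => //; apply/dist_at_mostP; exists 2; rewrite // has_walk2.
by apply/existsP; exists (inl p); rewrite /= pm.
Qed.

Lemma card_incidence_graph : #|G| = q.+1 * (q ^ 2 + 1) + q.+1 * (q ^ 2 + 1).
Proof.
have /card_gt0P[p0 _] := gq_points_nonempty gqI.
have /card_gt0P[l0 _] := gq_lines_nonempty gqI.
by rewrite card_sum (card_points quadI l0) (card_lines quadI p0).
Qed.

(** * Lower bound on the number of colors, and the equality case *)

Section Coloring.
Variables (k : nat) (c : G -> nat).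
Hypothesis cP : packing_coloring k c.

Let PC i := [set p | c (inl p) == i].
Let LC i := [set l | c (inr l) == i].
Let high := [set u | 3 < c u].

Lemma color_apart u v n : u != v -> c u = c v -> n <= c u -> ~~ has_walk n u v.
Proof.
move=> neq_uv eq_c le_n; have /andP[_ /forallP/(_ u)/forallP/(_ v)] := cP.
by rewrite neq_uv eq_c eqxx => /dist_at_leastP; apply; rewrite ltnS -eq_c.
Qed.

Lemma color_partial_ovoid i : 1 < i -> partial_ovoid I (PC i).
Proof.
move=> i_gt1 p r l; rewrite !inE => /eqP cp /eqP cr pl rl.
apply/eqP/negPn/negP=> neq_pr.
have /negP[] := @color_apart (inl p) (inl r) 2 neq_pr (etrans cp (esym cr)) ltac:(lia).
by rewrite has_walk2; apply/existsP; exists (inr l); rewrite /= pl.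
Qed.

Lemma color_partial_spread i : 1 < i -> partial_ovoid (dual I) (LC i).
Proof.
move=> i_gt1 l m p; rewrite !inE => /eqP cl /eqP cm pl pm.
apply/eqP/negPn/negP=> neq_lm.
have /negP[] := @color_apart (inr l) (inr m) 2 neq_lm (etrans cl (esym cm)) ltac:(lia).
by rewrite has_walk2; apply/existsP; exists (inl p); rewrite /= [I _ _]pl.
Qed.

Lemma color_independent i p l : 0 < i -> p \in PC i -> l \in LC i -> ~~ I p l.
Proof.
move=> i_gt0; rewrite !inE => /eqP cp /eqP cl.
by have := @color_apart (inl p) (inr l) 1 isT (etrans cp (esym cl)) ltac:(lia); rewrite has_walk1.
Qed.

(** A point and a line are joined by a walk of length 3, so they cannot both have color 3. *)
Lemma color3_card : #|PC 3| + #|LC 3| <= q ^ 2 + 1.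
Proof.
have leP3 := partial_ovoid_card quadI (@color_partial_ovoid 3 isT).
have leL3 := partial_ovoid_card (dual_quadrangle quadI) (@color_partial_spread 3 isT).
have [-> | [p]] := set_0Vmem (PC 3); first by rewrite cards0.
have [-> | [l]] := set_0Vmem (LC 3); first by rewrite cards0 addn0.
rewrite !inE => /eqP cl /eqP cp.
have [m [r [pm rm rl]]] := quad_proj quadI p l.
have /negP[] := @color_apart (inl p) (inr l) 3 isT (etrans cp (esym cl)) ltac:(lia).
by apply/has_walkP; exists [:: inr m; inl r; inr l]; rewrite /= pm rm rl.
Qed.

Lemma color_le u : 0 < c u <= k.
Proof. by have /andP[/forallP/(_ u)] := cP. Qed.

Lemma color_high_card : #|high| <= k - 3.
Proof.
have inj_c : {in high &, injective c}.
  move=> u v; rewrite inE => cu _ eq_c; apply/eqP/negPn/negP=> neq_uv.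
  have /dist_at_mostP[n le_n4] := (gq_diameter gqI).1 u v.
  by apply/negP; apply: color_apart => //; lia.
(* The colors above 3 are injective on vertices and lie in [iota 4 (k - 3)]. *)
rewrite cardE -(size_map c) -[leqRHS](size_iota 4); apply: uniq_leq_size.
  by rewrite map_inj_in_uniq ?enum_uniq // => u v; rewrite !mem_enum; apply: inj_c.
move=> _ /mapP[u + ->]; rewrite mem_enum mem_iota inE => cu.
by have := color_le u; lia.
Qed.

Lemma color_classes_card :
  #|G| = #|PC 1| + #|LC 1| + (#|PC 2| + #|LC 2|) + (#|PC 3| + #|LC 3|) + #|high|.
Proof.
have card_class i : #|PC i| + #|LC i| = \sum_(u : G) (c u == i).
  rewrite big_sumType; congr (_ + _).
    by rewrite card_sum_mem; apply: eq_bigr => p _; rewrite inE.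
  by rewrite card_sum_mem; apply: eq_bigr => l _; rewrite inE.
rewrite !card_class [#|high|]card_sum_mem -!big_split -sum1_card.
apply: eq_bigr => u _ /=; rewrite inE.
by have := color_le u; case: (c u) => [|[|[|[|n]]]].
Qed.

Lemma packing_coloring_bound :
  (q ^ 2 + 1) * (q - 1) + 3 <= k /\
  (k = (q ^ 2 + 1) * (q - 1) + 3 ->
     has_two_disjoint_ovoids I q \/ has_two_disjoint_spreads I q).
Proof.
have q_gt0 := gq_order_gt0 gqI.
have /card_gt0P[p0 _] := gq_points_nonempty gqI.
have disj (T : finType) (f : T -> nat) i j :
    i != j -> [disjoint [set x | f x == i] & [set x | f x == j]].
  move=> neq_ij; rewrite disjoint_subset; apply/subsetP=> x; rewrite !inE.
  by move/eqP->.
have [le12 eq12] := @card_independent_partial _ _ _ _ quadI (PC 1) (PC 2) (LC 1) (LC 2)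
  q_gt0 p0
  (@color_partial_ovoid 2 isT) (@color_partial_spread 2 isT)
  (disj _ _ 1 2 isT) (disj _ _ 1 2 isT)
  (fun p l => @color_independent 2 p l isT) (fun p l => @color_independent 1 p l isT).
have le3 := color3_card; have leh := color_high_card.
have := color_classes_card; rewrite card_incidence_graph => total.
have q_exp : 0 < q * (q ^ 2 + 1) by rewrite muln_gt0 q_gt0 addn1.
(* This keeps [k - 3] from being truncated. With fewer than 3 colors, colors 1 and 2 would have to
   cover all vertices, against [le12]. *)
have k_ge3 : 3 <= k.
  rewrite leqNgt; apply/negP=> k_lt3.
  have P3 : #|PC 3| = 0.
    by apply: eq_card0 => p; rewrite inE; apply/eqP=> Ec; have := color_le (inl p); lia.
  have L3 : #|LC 3| = 0.
    by apply: eq_card0 => l; rewrite inE; apply/eqP=> Ec; have := color_le (inr l); lia.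
  lia.
have sub1 : (q ^ 2 + 1) * (q - 1) + (q ^ 2 + 1) = q * (q ^ 2 + 1).
  by rewrite -[X in _ + X]muln1 -mulnDr subnK // mulnC.
split=> [|Ek]; first by lia.
(* For this [k] the bounds on the classes add up to exactly [#|G|], so each of them is tight. *)
have eq3 : #|PC 3| + #|LC 3| = q ^ 2 + 1 by lia.
have [|[X1 B2]|[Y1 A2]] := eq12; first by lia.
  have P3 : #|PC 3| = 0.
    by apply: eq_card0 => p; have := in_setT p; rewrite -X1 !inE => /eqP->.
  right; exists (LC 2), (LC 3); split; last exact: disj.
    exact: spread_of_partial (@color_partial_spread 2 isT) _.
  by apply: spread_of_partial (@color_partial_spread 3 isT) _; lia.
have L3 : #|LC 3| = 0.
  by apply: eq_card0 => l; have := in_setT l; rewrite -Y1 !inE => /eqP->.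
left; exists (PC 2), (PC 3); split; last exact: disj.
  exact: ovoid_of_partial (@color_partial_ovoid 2 isT) _.
by apply: ovoid_of_partial (@color_partial_ovoid 3 isT) _; lia.
Qed.

End Coloring.

(** * Optimal colorings from two disjoint ovoids or spreads *)

Lemma opposite_apart d (u v : G) : d <= 4 -> opposite u v -> dist_at_least d u v.
Proof. by move=> d_le4; rewrite /dist_at_least => ->. Qed.

Lemma same_kind_apart (u v : G) :
  is_point u = is_point v -> u != v -> dist_at_least 2 u v.
Proof.
move=> uv neq_uv; apply/dist_at_leastP=> -[|[|//]] _; apply/negP=> wn.
  by case/has_walkP: wn => -[[_ /= Euv _]|? ? [_ _]//]; rewrite Euv eqxx in neq_uv.
by have := walk_parity wn; rewrite uv addbb.
Qed.

(** Color 1 fills the side chosen by [b], and colors 2 and 3 are [S1] and [S2] on the other side,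
    where [(q + 1 - 2) * (q ^ 2 + 1)] vertices remain for single use. Ovoids take [b = false],
    spreads [b = true]. *)
Lemma packing_colorable_of_opposite (b : bool) (S1 S2 : {set G}) :
    #|[set u : G | is_point u == b]| = q.+1 * (q ^ 2 + 1) ->
    #|S1| = q ^ 2 + 1 -> #|S2| = q ^ 2 + 1 -> [disjoint S1 & S2] ->
    {in S1 :|: S2, forall u, is_point u = ~~ b} ->
    {in S1 &, forall u v, u != v -> opposite u v} ->
    {in S2 &, forall u v, u != v -> opposite u v} ->
  packing_colorable G ((q ^ 2 + 1) * (q - 1) + 3).
Proof.
set D := [set u | _] => card_D card1 card2 d12 S_kind op1 op2.
have := @packing_colorable_of_classes G D S1 S2.
have dDS : [disjoint D & S1 :|: S2].
  rewrite disjoint_subset; apply/subsetP=> u; rewrite !inE => /eqP uD.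
  by rewrite -in_setU; apply/negP=> /S_kind; rewrite uD; case: (b).
suff -> : #|~: (D :|: S1 :|: S2)| = (q ^ 2 + 1) * (q - 1).
  apply=> u v; first by rewrite !inE => /eqP uD /eqP vD; apply: same_kind_apart; rewrite uD vD.
    by move=> Su Sv neq_uv; apply: opposite_apart (op1 _ _ Su Sv neq_uv).
  by move=> Su Sv neq_uv; apply: opposite_apart (op2 _ _ Su Sv neq_uv).
have := cardsC (D :|: S1 :|: S2).
rewrite -setUA cardsU (disjoint_setI0 dDS) cardsU (disjoint_setI0 d12).
rewrite !cards0 !subn0 card_D card1 card2 [RHS]card_incidence_graph.
case: q (gq_order_gt0 gqI) => // q' _; rewrite subn1 /=; lia.
Qed.

Lemma card_kind (b : bool) : #|[set u : G | is_point u == b]| = q.+1 * (q ^ 2 + 1).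
Proof.
have /card_gt0P[p0 _] := gq_points_nonempty gqI.
have /card_gt0P[l0 _] := gq_lines_nonempty gqI.
rewrite card_sum_mem big_sumType /=; case: b.
  rewrite [X in _ + X]big1 ?addn0 => [|l _]; last by rewrite inE.
  rewrite -(card_points quadI l0) -sum1_card.
  by apply: eq_bigr => p _; rewrite inE.
rewrite [X in X + _]big1 ?add0n => [|p _]; last by rewrite inE.
rewrite -(card_lines quadI p0) -sum1_card.
by apply: eq_bigr => l _; rewrite inE.
Qed.

Lemma packing_colorable_of_ovoids :
  has_two_disjoint_ovoids I q -> packing_colorable G ((q ^ 2 + 1) * (q - 1) + 3).
Proof.
case=> O1 [O2 [[card1 op1 _] [card2 op2 _] d12]].
apply: (@packing_colorable_of_opposite false (inl @: O1) (inl @: O2)).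
- exact: card_kind.
- by rewrite card_imset //; apply: inl_inj.
- by rewrite card_imset //; apply: inl_inj.
- by rewrite imset_disjoint //; apply: inl_inj.
- by move=> u; rewrite inE => /orP[] /imsetP[p _ ->].
- by move=> _ _ /imsetP[p Op ->] /imsetP[r Or ->] neq; apply: op1.
by move=> _ _ /imsetP[p Op ->] /imsetP[r Or ->] neq; apply: op2.
Qed.

Lemma packing_colorable_of_spreads :
  has_two_disjoint_spreads I q -> packing_colorable G ((q ^ 2 + 1) * (q - 1) + 3).
Proof.
case=> S1 [S2 [[card1 op1 _] [card2 op2 _] d12]].
apply: (@packing_colorable_of_opposite true (inr @: S1) (inr @: S2)).
- exact: card_kind.
- by rewrite card_imset //; apply: inr_inj.
- by rewrite card_imset //; apply: inr_inj.
- by rewrite imset_disjoint //; apply: inr_inj.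
- by move=> u; rewrite inE => /orP[] /imsetP[l _ ->].
- by move=> _ _ /imsetP[l Sl ->] /imsetP[m Sm ->] neq; apply: op1.
by move=> _ _ /imsetP[l Sl ->] /imsetP[m Sm ->] neq; apply: op2.
Qed.

End IncidenceGraph.

Theorem corollary3p1 (q : nat) (P L : finType) (I : P -> L -> bool)
    (hQ : generalized_quadrangle I q) :
  (has_two_disjoint_ovoids I q \/ has_two_disjoint_spreads I q) <->
  packing_chromatic_number (incidence_graph I) = (q ^ 2 + 1) * (q - 1) + 3.
Proof.
rewrite /packing_chromatic_number; case: ex_minnP => k kG min_k.
have /packing_colorableP[c cP] := kG.
(* Applied to an optimal coloring, [eq_k] is already the backward implication, and [le_k] is half of
   the forward one. *)
have [le_k eq_k] := packing_coloring_bound hQ cP.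
split=> // H; apply/eqP; rewrite eqn_leq le_k andbT; apply: min_k.
by case: H => [/packing_colorable_of_ovoids | /packing_colorable_of_spreads]; apply.
Qed.
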